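(* Consider the contextual bilateral trade problem in the two-bit feedback model. There exists a profit-maximizing algorithm that achieves regret $O(d \log\log T + d\log d)$ and enforces per-round budget balance.
   Context: Contextual bilateral trade: Let $\mathbb{B}=\{w\in\mathbb{R}^d:\|w\|_2\le 1\}$. There are two fixed vectors $s,b\in\mathbb{B}$ unknown to the learner. At each time $t=1,\dots,T$, the learner observes a context $x_t\in\mathbb{B}$ (the contexts and $s,b$ are fixed in advance by an oblivious adversary; this is an instance), and posts a price $p_t$ to the seller and $q_t$ to the buyer. Valuations: $s_t=\langle s,x_t\rangle$, $b_t=\langle b,x_t\rangle$; the trade happens iff $s_t\le p_t$ and $q_t\le b_t$. Profit: $\mathrm{Profit}_t(p_t,q_t)=(q_t-p_t)\,\mathbb{1}\{s_t\le p_t\}\mathbb{1}\{q_t\le b_t\}$. Two-bit feedback: after each round the learner observes $(\mathbb{1}\{s_t\le p_t\},\mathbb{1}\{q_t\le b_t\})$. Regret of a (possibly randomized) profit-maximizing algorithm $\mathcal{A}$: $R_T(\mathcal{A})=\sup_{\mathcal{I}}\mathbb{E}\big[\sum_{t=1}^T (b_t-s_t)_+-\sum_{t=1}^T\mathrm{Profit}_t(p_t,q_t)\big]$. Per-round budget balance: $p_t\le q_t$ for every $t$. The $O(\cdot)$ hides absolute constants independent of $d$ and $T$. *)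

(* Defs.v *)
From Stdlib Require Import Reals.
From mathcomp Require Import all_boot all_algebra.
From mathcomp Require Import Rstruct.

Set Implicit Arguments.
Unset Strict Implicit.
Unset Printing Implicit Defensive.

Import GRing.Theory Num.Theory.
Local Open Scope ring_scope.

Definition vec (d : nat) := 'rV[R]_d.

Definition inner (d : nat) (u v : vec d) : R := \sum_(i < d) u 0 i * v 0 i.

Definition in_ball (d : nat) (w : vec d) : Prop := inner w w <= 1.

(* Two-bit feedback of a round: (1{s_t <= p_t}, 1{q_t <= b_t}). *)
Definition feedback := (bool * bool)%type.

(* A deterministic learner (policy): given the history of past rounds
   (observed contexts and the two-bit feedback received) and the current
   context x_t, it posts the pair of prices (p_t, q_t)
   (p_t to the seller, q_t to the buyer). *)
Definition policy (d : nat) := seq (vec d * feedback) -> vec d -> (R * R).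

Section Run.
Variables (d : nat) (A : policy d) (s b : vec d) (x : nat -> vec d).

Definition sval (t : nat) : R := inner s (x t).
Definition bval (t : nat) : R := inner b (x t).

Definition fb_of (t : nat) (pq : R * R) : feedback :=
  (sval t <= pq.1, pq.2 <= bval t).

Fixpoint hist (t : nat) : seq (vec d * feedback) :=
  match t with
  | 0 => [::]
  | t'.+1 => rcons (hist t') (x t', fb_of t' (A (hist t') (x t')))
  end.

Definition prices (t : nat) : R * R := A (hist t) (x t).

Definition profit (t : nat) : R :=
  let pq := prices t in
  if (sval t <= pq.1) && (pq.2 <= bval t) then pq.2 - pq.1 else 0.

Definition det_regret (T : nat) : R :=
  \sum_(t < T) Num.max (bval t - sval t) 0 - \sum_(t < T) profit t.

End Run.

(* A (possibly randomized) algorithm: a probability distribution with finite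
   support over deterministic policies, given as a list of
   (probability weight, policy) pairs. *)
Definition rand_alg (d : nat) := seq (R * policy d).

Definition is_distribution (d : nat) (L : rand_alg d) : Prop :=
  (forall wa, List.In wa L -> 0 <= wa.1) /\ \sum_(wa <- L) wa.1 = 1.

(* Expected regret of a randomized algorithm on a fixed instance
   (s, b, x) fixed in advance by an oblivious adversary. *)
Definition exp_regret (d : nat) (L : rand_alg d) (s b : vec d)
  (x : nat -> vec d) (T : nat) : R :=
  \sum_(wa <- L) wa.1 * det_regret wa.2 s b x T.

Definition instance (d : nat) (s b : vec d) (x : nat -> vec d) (T : nat)
  : Prop :=
  in_ball s /\ in_ball b /\ (forall t, (t < T)%N -> in_ball (x t)).

Definition budget_balanced (d : nat) (L : rand_alg d) (T : nat) : Prop :=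
  forall wa, List.In wa L -> forall s b x, instance s b x T ->
    forall t, (t < T)%N -> (prices wa.2 s b x t).1 <= (prices wa.2 s b x t).2.

(* Main.v *)
Require Import Defs.
From Stdlib Require Import Reals.
From mathcomp Require Import all_boot all_order all_algebra.
From mathcomp Require Import boolp classical_sets reals Rstruct.
From mathcomp Require Import ring lra.
Import Order.TTheory GRing.Theory Num.Theory.
Local Open Scope ring_scope.

(* The learner keeps, for the seller and for the buyer, the convex set K of value
   vectors consistent with the feedback.  Level k of the algorithm treats contexts
   x in which K has width about w_k, where w_(k+1) is of order w_k^2, and measures
   progress by the volume of K thickened by z_k = poly(w_k / d).  By convexity a
   slab of width O(d z_k) carries only a small part of the thickened set, so some
   price leaves a fraction of order sqrt(w_k) of it on the rejecting side.  A
   rejection loses O(1) but divides the volume by about 1 / sqrt(w_k); an acceptance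
   loses O(w_k) and still removes a fraction of order sqrt(w_k).  The logarithm of
   the volume varies by at most d ln (4 / z_k) = O(d 2^k + d ln d), so weighting it
   by 2^-k and summing over the log log T levels down to width 1 / T bounds the
   total loss.  If the seller's price p exceeds the buyer's, posting p to both costs
   no more: whenever only the buyer declines, b < p and the gain from trade is at
   most p - s, which the seller's acceptance pays for. *)

Set Implicit Arguments.
Unset Strict Implicit.
Unset Printing Implicit Defensive.

(* Otherwise numerals and operations of type [R] are read as Stdlib's. *)
Bind Scope ring_scope with R.
Local Arguments ln x%_ring_scope.

(** * Inner products and the unit ball *)

Section Inner.
Variable d : nat.
Implicit Types u v x y : 'rV[R]_d.

Lemma innerD u v x : inner (u + v) x = inner u x + inner v x.
Proof.
by rewrite /inner -big_split; apply: eq_bigr => i _; rewrite mxE mulrDl.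
Qed.

Lemma innerZ a u x : inner (a *: u) x = a * inner u x.
Proof. by rewrite /inner mulr_sumr; apply: eq_bigr => i _; rewrite mxE mulrA. Qed.

Lemma innerN u x : inner (- u) x = - inner u x.
Proof. by rewrite -scaleN1r innerZ mulN1r. Qed.

Lemma innerNr u x : inner u (- x) = - inner u x.
Proof. by rewrite /inner -sumrN; apply: eq_bigr => i _; rewrite mxE mulrN. Qed.

Lemma inner_conv l u v x :
  inner ((1 - l) *: u + l *: v) x = (1 - l) * inner u x + l * inner v x.
Proof. by rewrite innerD !innerZ. Qed.

Lemma inner_le_sup u x (r : R) : (forall i, `|u 0 i| <= r) ->
  (forall i, `|x 0 i| <= 1) -> `|inner u x| <= d%:R * r.
Proof.
move=> ur x1; apply: le_trans (ler_norm_sum _ _ _) _.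
rewrite mulr_natl -[d in X in _ <= X]card_ord -sumr_const; apply: ler_sum => i _.
rewrite normrM -[r]mulr1.
by apply: ler_pM => //; exact: normr_ge0.
Qed.

Lemma in_ball_coord x i : in_ball x -> `|x 0 i| <= 1.
Proof.
rewrite /in_ball /inner (bigD1 i) //= => x1.
have : 0 <= \sum_(j < d | j != i) x 0 j * x 0 j.
  by apply: sumr_ge0 => j _; rewrite -expr2 sqr_ge0.
rewrite ler_norml => s0; apply/andP; split; nra.
Qed.

(** Cauchy-Schwarz on the unit ball without square roots: expand the square norms of [u + v] and
    [u - v], which are nonnegative. *)
Lemma inner_ball u v : in_ball u -> in_ball v -> `|inner u v| <= 1.
Proof.
rewrite /in_ball => u1 v1.
have h (w : 'rV[R]_d) : 0 <= inner w w.
  by apply: sumr_ge0 => j _; rewrite -expr2 sqr_ge0.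
have e (a : R) : inner (u + a *: v) (u + a *: v) =
    inner u u + a * inner u v *+ 2 + a ^+ 2 * inner v v.
  rewrite /inner mulr_sumr mulr_sumr -sumrMnl -!big_split /=.
  by apply: eq_bigr => i _; rewrite !mxE mulr2n; ring.
have := h (u + 1 *: v); have := h (u + (-1) *: v); rewrite !e ler_norml.
by move=> *; apply/andP; split; lra.
Qed.

Lemma in_ballN v : in_ball v -> in_ball (- v).
Proof. by rewrite /in_ball innerN innerNr opprK. Qed.

End Inner.

(** * Outer volume through finite covers by cubes *)

Section Volume.
Variable d : nat.
Implicit Types (x y c : 'rV[R]_d) (A B C : 'rV[R]_d -> Prop).

Definition cube c (r : R) y : Prop := forall i, c 0 i <= y 0 i <= c 0 i + r.

Definition covers (s : seq ('rV[R]_d * R)) A : Prop :=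
  (forall q, q \in s -> 0 < q.2) /\
  forall y, A y -> exists2 q, q \in s & cube q.1 q.2 y.

Definition cover_vol (s : seq ('rV[R]_d * R)) : R := \sum_(q <- s) q.2 ^+ d.

Definition coverable A : Prop := exists s, covers s A.

(* Finite covers already determine the volume of the bounded convex sets that
   matter here; on a set without a finite cover the infimum is a junk value. *)
Definition vol A : R := inf [set t | exists2 s, covers s A & cover_vol s = t]%classic.

Lemma cover_vol_ge0 s A : covers s A -> 0 <= cover_vol s.
Proof.
move=> [s0 _]; rewrite /cover_vol big_seq; apply: sumr_ge0 => q /s0 q0.
by rewrite exprn_ge0 // ltW.
Qed.

Lemma vol_le s A : covers s A -> vol A <= cover_vol s.
Proof.
move=> cs; apply: ge_inf; last by exists s.
by exists 0 => _ [s' c' <-]; exact: cover_vol_ge0 c'.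
Qed.

Lemma vol_ge A (t : R) : coverable A ->
  (forall s, covers s A -> t <= cover_vol s) -> t <= vol A.
Proof.
move=> [s cs] h; apply: lb_le_inf; first by exists (cover_vol s), s.
by move=> _ [s' c' <-]; exact: h.
Qed.

Lemma vol_ge0 A : coverable A -> 0 <= vol A.
Proof. by move=> cA; apply: vol_ge => // s; exact: cover_vol_ge0. Qed.

Lemma coversS s A B : (forall y, A y -> B y) -> covers s B -> covers s A.
Proof. by move=> AB [s0 sB]; split=> // y /AB; exact: sB. Qed.

Lemma coverableS A B : (forall y, A y -> B y) -> coverable B -> coverable A.
Proof. by move=> AB [s /(coversS AB)]; exists s. Qed.

Lemma vol_mono A B : (forall y, A y -> B y) -> coverable B -> vol A <= vol B.
Proof. by move=> AB cB; apply: vol_ge => // s /(coversS AB); exact: vol_le. Qed.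

Lemma vol_set0 A : (forall y, ~ A y) -> vol A = 0.
Proof.
move=> A0; have c0 : covers [::] A by split=> // y /A0.
apply/eqP; rewrite eq_le vol_ge0 ?andbT; last by exists [::].
by rewrite (le_trans (vol_le c0)) // /cover_vol big_nil.
Qed.

Lemma vol_subadd A B C : (forall y, A y -> B y \/ C y) ->
  coverable B -> coverable C -> vol A <= vol B + vol C.
Proof.
move=> ABC cB cC; rewrite -lerBlDr; apply: vol_ge => // s cs.
rewrite lerBlDr -lerBlDl; apply: vol_ge => // s' cs'.
rewrite lerBlDl; have -> : cover_vol s + cover_vol s' = cover_vol (s ++ s').
  by rewrite /cover_vol big_cat.
apply: vol_le; case: cs cs' => [s0 sB] [s'0 s'C]; split.
  by move=> q; rewrite mem_cat => /orP[/s0|/s'0].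
move=> y /ABC[/sB|/s'C] [q qs yq]; exists q => //.
  by rewrite mem_cat qs.
by rewrite mem_cat qs orbT.
Qed.

(** Dyadic subdivision into [2^d] cubes; [f i] selects the upper half in coordinate [i]. *)
Definition halves (q : 'rV[R]_d * R) : seq ('rV[R]_d * R) :=
  [seq (\row_i (q.1 0 i + (if f i then q.2 / 2 else 0)), q.2 / 2)
     | f : {ffun 'I_d -> bool}].

Lemma cover_vol_halves q : cover_vol (halves q) = q.2 ^+ d.
Proof.
rewrite /cover_vol /halves big_image /= sumr_const card_ffun card_bool card_ord.
by rewrite -[LHS]mulr_natl natrX -exprMn; congr (_ ^+ _); field.
Qed.

Lemma halves_side q q' : q' \in halves q -> q'.2 = q.2 / 2.
Proof. by rewrite /halves => /fintype.imageP[f _ ->]. Qed.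

Lemma covers_halves s A : covers s A -> covers (flatten [seq halves q | q <- s]) A.
Proof.
move=> [s0 sA]; split.
  move=> q /flattenP[l /mapP[q0 q0s ->]] /halves_side->.
  by rewrite divr_gt0 // s0.
move=> y /sA[q qs yq].
pose f := [ffun i => q.1 0 i + q.2 / 2 < y 0 i].
exists (\row_i (q.1 0 i + (if f i then q.2 / 2 else 0)), q.2 / 2).
  apply/flattenP; exists (halves q); first exact: map_f.
  by rewrite /halves; apply/fintype.imageP; exists f.
move=> i /=; rewrite mxE ffunE; have := yq i => /andP[h1 h2].
by case: ltP => h; apply/andP; split; lra.
Qed.

Lemma covers_fine s A (e : R) : 0 < e -> covers s A ->
  exists s', [/\ covers s' A, cover_vol s' = cover_vol s & forall q, q \in s' -> q.2 <= e].
Proof.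
move=> e0 cs.
have [n] : exists n, forall q, q \in s -> q.2 <= e * 2 ^+ n.
  pose M := \sum_(q <- s) `|q.2|.
  exists (Num.bound (M / e)) => q qs.
  have /ltW : M / e < 2 ^+ Num.bound (M / e) by apply: upper_nthrootP.
  rewrite ler_pdivrMr // mulrC; apply: le_trans.
  apply: le_trans (ler_norm _) _; rewrite /M (big_rem q) //= lerDl.
  by apply: sumr_ge0 => *; exact: normr_ge0.
elim: n s cs => [|n IH] s cs h; first by exists s; split=> // q /h; rewrite mulr1.
have [|s' [c' t' l']] := IH _ (covers_halves cs).
  move=> q /flattenP[l /mapP[q0 q0s ->]] /halves_side->.
  by have := h _ q0s; rewrite exprS; lra.
exists s'; split => //; rewrite t' /cover_vol big_flatten big_map.
by apply: eq_bigr => q _; exact: cover_vol_halves.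
Qed.

(** A cover refined to cubes too small to bridge the gap [e] splits into the cubes that meet [A] and
    the rest, and the rest must cover [B]. *)
Lemma vol_superadd A B C x (e : R) : (forall i, `|x 0 i| <= 1) -> 0 < e ->
  (forall y y', A y -> B y' -> inner y x + e <= inner y' x) ->
  (forall y, A y -> C y) -> (forall y, B y -> C y) -> coverable C ->
  vol A + vol B <= vol C.
Proof.
move=> x1 e0 sep AC BC cC; apply: vol_ge => // s0 cs0.
(* Dividing by [d + 1] keeps [d] times the side strictly below [e], even for [d = 0]. *)
have r0 : 0 < e / d.+1%:R by rewrite divr_gt0.
have [s [[sp sC] <- sr]] := covers_fine r0 cs0.
pose P q := `[< exists2 y, A y & cube q.1 q.2 y >].
have -> : cover_vol s = cover_vol [seq q <- s | P q] + cover_vol [seq q <- s | ~~ P q].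
  by rewrite /cover_vol !big_filter (bigID P).
apply: lerD; apply: vol_le; split.
- by move=> q; rewrite mem_filter => /andP[_ /sp].
- move=> y Ay; have [q qs yq] := sC _ (AC _ Ay); exists q => //.
  by rewrite mem_filter qs andbT; apply/asboolP; exists y.
- by move=> q; rewrite mem_filter => /andP[_ /sp].
move=> y By; have [q qs yq] := sC _ (BC _ By); exists q => //.
rewrite mem_filter qs andbT; apply/asboolP => -[y0 Ay0 y0q].
have : `|inner (y - y0) x| <= d%:R * (e / d.+1%:R).
  move: (e / _) sr => r sr.
  apply: inner_le_sup => // i; rewrite !mxE.
  have := yq i; have := y0q i; have := sr _ qs.
  by rewrite ler_norml => ? /andP[? ?] /andP[? ?]; apply/andP; split; lra.
have := sep _ _ Ay0 By; rewrite innerD innerN => h.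
have lt : d%:R * (e / d.+1%:R) < e.
  by rewrite mulrA ltr_pdivrMr // mulrC ltr_pM2l // ltr_nat.
by move=> /(le_trans (ler_norm _)) /le_lt_trans /(_ lt); lra.
Qed.

(** A cover of [B] pulled back along the contraction covers [A], with every side divided by
    [1 - l]. *)
Lemma vol_contract A B (l : R) v : 0 <= l < 1 ->
  (forall y, A y -> B ((1 - l) *: y + l *: v)) -> coverable B ->
  (1 - l) ^+ d * vol A <= vol B.
Proof.
move=> /andP[l0 l1] AB cB; apply: vol_ge => // s [s0 sB].
have l'0 : 0 < 1 - l by rewrite subr_gt0.
pose s' := [seq ((1 - l)^-1 *: (q.1 - l *: v), q.2 / (1 - l)) | q <- s].
have -> : cover_vol s = (1 - l) ^+ d * cover_vol s'.
  rewrite /cover_vol big_map mulr_sumr; apply: eq_bigr => q _ /=.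
  by rewrite -exprMn mulrC divfK // gt_eqF.
apply: ler_wpM2l; first by rewrite exprn_ge0 // ltW.
apply: vol_le; split.
  by move=> _ /mapP[q qs ->] /=; rewrite divr_gt0 // s0.
move=> y /AB/sB[q qs yq].
exists ((1 - l)^-1 *: (q.1 - l *: v), q.2 / (1 - l)); first exact: map_f.
move=> i /=; have := yq i; rewrite !mxE => /andP[h1 h2].
rewrite [_^-1 * _]mulrC -mulrDl ler_pdivrMr // ler_pdivlMr //.
by apply/andP; split; lra.
Qed.

Lemma covers_cube c (r : R) : 0 < r -> covers [:: (c, r)] (cube c r).
Proof.
move=> r0; split; first by move=> q; rewrite inE => /eqP->.
by move=> y yc; exists (c, r) => //; rewrite inE.
Qed.

Lemma card_close n (A : {set 'I_n}) (r : R) : 0 <= r ->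
  (forall i j, i \in A -> j \in A -> j%:R - i%:R <= r) -> #|A|%:R <= r + 1.
Proof.
move=> r0 h; have [->|[i0 i0A]] := set_0Vmem A; first by rewrite cards0; lra.
pose m := [arg min_(i < i0 in A) i]; pose M := [arg max_(i > i0 in A) i].
have [mA mP] : m \in A /\ forall j, j \in A -> (m <= j)%N.
  by rewrite /m; case: arg_minnP.
have [MA MP] : M \in A /\ forall j, j \in A -> (j <= M)%N.
  by rewrite /M; case: arg_maxnP.
have mM : (m <= M)%N by exact: MP.
apply: le_trans (_ : (M - m).+1%:R <= _); last first.
  by rewrite -natr1 natrB // lerD2r; exact: h.
rewrite ler_nat -[X in (_ <= X)%N](size_iota m) cardE.
rewrite -(size_map (@nat_of_ord n)); apply: uniq_leq_size.
  by rewrite map_inj_uniq ?enum_uniq //; exact: val_inj.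
move=> k /mapP[j]; rewrite mem_enum => jA -> {k}.
by rewrite mem_iota mP //= -subSn // subnKC ?ltnS ?MP // leqW.
Qed.

(* Count the points of a grid so fine that every cube of the cover is at least
   one mesh wide. *)
Lemma vol_cube_ge c (a : R) : 0 < a -> (a / 2) ^+ d <= vol (cube c a).
Proof.
move=> a0; apply: vol_ge; first by eexists; apply: covers_cube.
move=> s [s0 sA].
have [n n0 hn] : exists2 n, (0 < n)%N & forall q, q \in s -> 1 <= q.2 * n%:R / a.
  pose M := \sum_(q <- s) `|a / q.2|.
  exists (Num.bound M).+1 => // q qs; have q0 := s0 _ qs.
  rewrite ler_pdivlMr // mul1r mulrC -ler_pdivrMr //.
  apply: le_trans (ler_norm _) _; apply: le_trans (_ : M <= _).
    by rewrite /M (big_rem q) //= lerDl; apply: sumr_ge0 => *; exact: normr_ge0.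
  rewrite -natr1 ler_wpDr // ltW //.
  by apply: archi_boundP; apply: sumr_ge0 => *; exact: normr_ge0.
have n0' : 0 < n%:R :> R by rewrite ltr0n.
pose pt (f : {ffun 'I_d -> 'I_n}) : 'rV[R]_d := \row_i (c 0 i + a * (f i)%:R / n%:R).
pose I (q : 'rV[R]_d * R) i :=
  [set j : 'I_n | q.1 0 i <= c 0 i + a * j%:R / n%:R <= q.1 0 i + q.2].
(* Each cube is at least one mesh wide, so the [+ 1] of [card_close] at most doubles the count;
   hence the [a / 2] of the statement. *)
have Icard q i : q \in s -> #|I q i|%:R <= 2 * (q.2 * n%:R / a).
  move=> qs; have h1 := hn _ qs; have q0 := s0 _ qs.
  apply: le_trans (_ : q.2 * n%:R / a + 1 <= _); last by lra.
  apply: card_close => [|j k]; first by lra.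
  rewrite !inE => /andP[lj _] /andP[_ uk].
  by rewrite ler_pdivlMr // -ler_pdivrMr // [_ * a]mulrC mulrBr mulrBl; lra.
(* Double counting: each of the [n^d] grid points lies in some cube of the cover. *)
have count : (n ^ d)%:R <= \sum_(q <- s) (2 * (q.2 * n%:R / a)) ^+ d :> R.
  rewrite -[X in (X ^ _)%N]card_ord -[X in (_ ^ X)%N]card_ord -card_ffun.
  apply: le_trans (_ : \sum_(q <- s)
    #|[set f : {ffun 'I_d -> 'I_n} | [forall i, f i \in I q i]]|%:R <= _).
    rewrite -natr_sum ler_nat.
    under eq_bigr do rewrite -sum1dep_card big_mkcond.
    rewrite exchange_big /= -sum1_card; apply: leq_sum => f _.
    have [|q qs fq] := sA (pt f).
      move=> i; rewrite mxE lerDl -mulrA; apply/andP; split.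
        by rewrite mulr_ge0 ?divr_ge0 // ltW.
      rewrite lerD2l -[leRHS]mulr1 ler_pM2l // ler_pdivrMr // mul1r ler_nat.
      exact: ltnW.
    rewrite (big_rem q) //= ifT // .
    by apply/forallP => i; rewrite inE; have := fq i; rewrite mxE.
  rewrite big_seq [leRHS]big_seq; apply: ler_sum => q qs.
  have -> : #|[set f : {ffun 'I_d -> 'I_n} | [forall i, f i \in I q i]]| =
            (\prod_i #|I q i|)%N.
    rewrite (_ : #|_| = #|family (fun i => mem (I q i))|).
      by rewrite card_family foldrE big_image /=.
    by apply: eq_card => f; rewrite inE; apply/forallP/familyP.
  rewrite natr_prod.
  have -> (b : R) : b ^+ d = \prod_(i < d) b by rewrite prodr_const card_ord.
  apply: ler_prod => i _.
  by rewrite ler0n Icard.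
have -> : cover_vol s = (a / 2 / n%:R) ^+ d * \sum_(q <- s) (2 * (q.2 * n%:R / a)) ^+ d.
  rewrite /cover_vol mulr_sumr; apply: eq_bigr => q _; rewrite -exprMn.
  by congr (_ ^+ _); field; rewrite !gt_eqF.
apply: le_trans (_ : (a / 2 / n%:R) ^+ d * (n ^ d)%:R <= _).
  by rewrite natrX -exprMn divfK // gt_eqF.
by rewrite ler_wpM2l // exprn_ge0 // !divr_ge0 // ltW.
Qed.
End Volume.

(** * Light slabs and balanced cuts of thickened convex sets *)

Section Cut.
Variable d : nat.
Hypothesis d0 : (0 < d)%N.
Implicit Types (r z : R) (x y u v : 'rV[R]_d) (K L : 'rV[R]_d -> Prop).

Definition cvx K : Prop := forall (l : R) u v, 0 <= l <= 1 ->
  K u -> K v -> K ((1 - l) *: u + l *: v).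

Lemma bernoulli (l : R) n : 0 <= l <= 1 -> 1 - n%:R * l <= (1 - l) ^+ n.
Proof.
move=> /andP[l0 l1]; elim: n => [|n IH]; first by rewrite expr0; lra.
rewrite exprS -natr1.
apply: le_trans (_ : (1 - l) * (1 - n%:R * l) <= _).
  by have : 0 <= n%:R :> R by []; nra.
by rewrite ler_wpM2l // subr_ge0.
Qed.

(* Contracting the slab towards [v] by the factors [1 - 2 j w / g] produces [J]
   disjoint copies inside [L], each of at least half the volume of the slab. *)
Lemma slab_vol_toward L x v (a w : R) (J : nat) : cvx L -> coverable L ->
  (forall i, `|x 0 i| <= 1) -> 0 < w -> L v ->
  J%:R * (4 * d%:R * w) <= inner v x - a ->
  J%:R * vol (fun y => L y /\ a <= inner y x <= a + w) <= 2 * vol L.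
Proof.
move=> cL bL x1 w0 Lv hJ; set S := fun y => _.
have bsub (P : 'rV[R]_d -> Prop) : coverable (fun y => L y /\ P y).
  by apply: coverableS bL => y [].
have d0' : 1 <= d%:R :> R by rewrite ler1n.
have vS : 0 <= vol S by apply: vol_ge0; exact: bsub.
(* The copies made so far end at level [a + 2 j w - w] and the next one starts at [a + 2 j w]; the
   gap [w] between them is what [vol_superadd] needs. *)
suff h j : (j <= J)%N ->
    j%:R * (vol S / 2) <= vol (fun y => L y /\ inner y x <= a + 2 * j%:R * w - w).
  have := h J (leqnn J).
  have : vol (fun y => L y /\ inner y x <= a + 2 * J%:R * w - w) <= vol L.
    by apply: vol_mono => // y [].
  lra.
elim: j => [_|j IH jJ]; first by rewrite mul0r; apply: vol_ge0; exact: bsub.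
set g := inner v x - a in hJ.
have hj : j.+1%:R * (4 * d%:R * w) <= g.
  by apply: le_trans hJ; rewrite ler_wpM2r ?ler_nat // ltW // !mulr_gt0 //; lra.
have j0 : 0 <= j%:R :> R by [].
have dw : w <= d%:R * w by rewrite ler_peMl // ltW.
have g0 : 0 < g.
  apply: lt_le_trans hj; rewrite !mulr_gt0 //; lra.
pose l := 2 * j%:R * w / g.
have lg : l * g = 2 * j%:R * w by rewrite /l divfK // gt_eqF.
have l0 : 0 <= l by rewrite divr_ge0 ?mulr_ge0 // ltW.
(* With this, [bernoulli] gives [(1 - l)^d >= 1 / 2]. *)
have ld : d%:R * l <= 1 / 2.
  rewrite /l mulrA ler_pdivrMr //; move: hj; rewrite -natr1; nra.
have l1 : l < 1 by have := ler_peMl l0 d0'; lra.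
have vB : vol S / 2 <= vol (fun y =>
     L y /\ a + 2 * j%:R * w <= inner y x <= a + 2 * j%:R * w + w).
  apply: le_trans (_ : (1 - l) ^+ d * vol S <= _).
    have := @bernoulli l d; rewrite l0 ltW // => /(_ isT) h; nra.
  apply: (@vol_contract _ _ _ _ v); [by rewrite l0| |exact: bsub].
  move=> y [Ly /andP[y1 y2]]; split; first by apply: cL; rewrite ?l0 ?ltW.
  rewrite inner_conv.
  have -> : inner v x = a + g by rewrite /g; ring.
  by apply/andP; split; nra.
apply: le_trans (_ : vol (fun y => L y /\ inner y x <= a + 2 * j%:R * w - w) +
  vol (fun y => L y /\ a + 2 * j%:R * w <= inner y x <= a + 2 * j%:R * w + w) <= _).
  by rewrite -[j.+1%:R]natr1 mulrDl mul1r lerD // IH // ltnW.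
apply: (vol_superadd x1 w0); last exact: bsub.
- by move=> y y' [_ h] [_ /andP[h' _]]; lra.
- by move=> y [Ly h]; split=> //; rewrite -[j.+1%:R]natr1; lra.
- by move=> y [Ly /andP[_ h]]; split=> //; rewrite -[j.+1%:R]natr1; lra.
Qed.

(** One of [u], [v] lies at least [g / 2] from the face of the slab opposite to it. Contracting
    towards that point fits [J] copies with [4 <= J e <= 5]; reflecting [x] reduces the case of [u]
    to that of [v]. *)
Lemma slab_vol L x u v (a w g e : R) : cvx L -> coverable L ->
  (forall i, `|x 0 i| <= 1) -> L u -> L v -> g <= inner v x - inner u x ->
  0 < w -> 0 < e <= 1 -> 40 * d%:R * w <= g * e ->
  vol (fun y => L y /\ a <= inner y x <= a + w) <= e / 2 * vol L.
Proof.
move=> cL bL x1 Lu Lv hg w0 /andP[e0 e1] hw.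
pose J := (Num.truncn (4 / e)).+1.
have e4 : 0 <= 4 / e by rewrite divr_ge0 // ltW.
have J1 : 4 <= J%:R * e by rewrite -ler_pdivrMr // ltW // truncnS_gt.
have J2 : J%:R * e <= 5.
  have : (Num.truncn (4 / e))%:R <= 4 / e by rewrite truncn_le.
  by rewrite ler_pdivlMr // /J -[(Num.truncn _).+1%:R]natr1; lra.
have J0 : 0 <= J%:R :> R by [].
have hJ : J%:R * (8 * d%:R * w) <= g.
  rewrite -(ler_pM2r e0); apply: le_trans hw.
  have dw : 0 <= d%:R * w by rewrite mulr_ge0 // ltW.
  by have := ler_wpM2r dw J2; lra.
set S := fun y => _.
have vL := vol_ge0 bL.
suff : J%:R * vol S <= 2 * vol L.
  move=> h; have : J%:R * e * vol S <= 2 * e * vol L by nra.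
  have : 0 <= vol S by apply: vol_ge0; apply: coverableS bL => y [].
  by nra.
have [am|am] := leP a ((inner u x + inner v x) / 2).
  by apply: (@slab_vol_toward _ _ v) => //; lra.
have -> : S = fun y => L y /\ - a - w <= inner y (- x) <= - a - w + w.
  apply/funext => y; apply/propext; rewrite /S innerNr.
  by split=> -[Ly /andP[h1 h2]]; split=> //; apply/andP; split; lra.
apply: (@slab_vol_toward _ _ u) => // [i|]; first by rewrite mxE normrN.
by rewrite innerNr; lra.
Qed.

Definition thicken (z : R) K y : Prop :=
  exists2 k, K k & forall i, `|y 0 i - k 0 i| <= z.

Lemma thickenS z K K' y : (forall k, K k -> K' k) -> thicken z K y -> thicken z K' y.
Proof. by move=> KK' [k /KK' Kk h]; exists k. Qed.

Lemma sub_thicken z K y : 0 <= z -> K y -> thicken z K y.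
Proof. by move=> z0 Ky; exists y => // i; rewrite subrr normr0. Qed.

Lemma cvx_thicken z K : cvx K -> cvx (thicken z K).
Proof.
move=> cK l u v /andP[l0 l1] [k Kk hk] [k' Kk' hk'].
exists ((1 - l) *: k + l *: k'); first by apply: cK; rewrite ?l0.
move=> i; rewrite !mxE.
have := hk i; have := hk' i; rewrite !ler_norml => /andP[? ?] /andP[? ?].
by apply/andP; split; nra.
Qed.

Lemma inner_thicken z K x y : (forall i, `|x 0 i| <= 1) -> thicken z K y ->
  exists2 k, K k & `|inner y x - inner k x| <= d%:R * z.
Proof.
move=> x1 [k Kk h]; exists k => //; rewrite -innerN -innerD.
by apply: inner_le_sup => // i; rewrite !mxE.
Qed.

Definition in_box K : Prop := forall y, K y -> forall i, `|y 0 i| <= 1.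

Lemma thicken_cube z K : z <= 1 -> in_box K ->
  forall y, thicken z K y -> cube (const_mx (- 2)) 4 y.
Proof.
move=> z1 bK y [k Kk h] i; rewrite mxE; have := bK _ Kk i; have := h i.
by rewrite !ler_norml => /andP[? ?] /andP[? ?]; apply/andP; split; lra.
Qed.

Lemma thicken_coverable z K : z <= 1 -> in_box K -> coverable (thicken z K).
Proof.
move=> z1 bK; apply: coverableS (thicken_cube z1 bK) _.
by eexists; apply: covers_cube.
Qed.

Lemma vol_thicken_le z K : z <= 1 -> in_box K -> vol (thicken z K) <= 4 ^+ d.
Proof.
move=> z1 bK; apply: le_trans (_ : vol (cube (const_mx (- 2) : 'rV[R]_d) 4) <= _).
  apply: vol_mono (thicken_cube z1 bK) _.
  by eexists; apply: covers_cube.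
have h4 : 0 < 4 :> R by [].
by have := vol_le (covers_cube (const_mx (- 2) : 'rV[R]_d) h4); rewrite /cover_vol big_seq1.
Qed.

(** The thickened set contains a cube of side [2 z]; the 2 offsets the factor lost in
    [vol_cube_ge]. *)
Lemma vol_thicken_ge z K v : 0 < z <= 1 -> in_box K -> K v ->
  z ^+ d <= vol (thicken z K).
Proof.
move=> /andP[z0 z1] bK Kv.
pose c : 'rV[R]_d := \row_i (v 0 i - z).
apply: le_trans (_ : vol (cube c (2 * z)) <= _).
  have z2 : 0 < 2 * z by lra.
  by apply: le_trans (vol_cube_ge c z2); rewrite [2 * z]mulrC mulfK ?pnatr_eq0.
apply: vol_mono (thicken_coverable z1 bK) => y yc; exists v => // i.
have := yc i; rewrite mxE ler_norml => /andP[? ?].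
by apply/andP; split; lra.
Qed.

(* The price is the first point of a scan in steps of [d z] below which a
   fraction [e] of the thickened set lies; thin slabs being light, the fraction
   hardly changes when the price moves by the thickening. *)
Lemma exists_cut K x u v (z e g : R) : cvx K -> in_box K ->
  (forall i, `|x 0 i| <= 1) -> K u -> K v -> g <= inner v x - inner u x ->
  0 < z <= 1 -> 0 < e < 1 -> 80 * d%:R ^+ 2 * z <= g * e ->
  exists p : R, [/\ exists2 y, K y & inner y x <= p + d%:R * z,
    vol (thicken z (fun y => K y /\ inner y x < p)) <= 2 * e * vol (thicken z K) &
    forall p' : R, p <= p' -> vol (thicken z (fun y => K y /\ p' <= inner y x))
      <= (1 - e / 2) * vol (thicken z K)].
Proof.
move=> cK bK x1 Ku Kv hg /andP[z0 z1] /andP[e0 e1] hz.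
set L := thicken z K; set b := d%:R * z.
have d1 : 1 <= d%:R :> R by rewrite ler1n.
have b0 : 0 < b by rewrite mulr_gt0 //; lra.
have bL : coverable L by exact: thicken_coverable.
have bsub (P : 'rV[R]_d -> Prop) : coverable (fun y => L y /\ P y).
  by apply: coverableS bL => y [].
have vL : 0 < vol L.
  by apply: lt_le_trans (vol_thicken_ge _ bK Ku); rewrite ?exprn_gt0 ?z0.
have slab a : vol (fun y => L y /\ a <= inner y x <= a + 2 * b) <= e / 2 * vol L.
  apply: (@slab_vol _ _ u v _ _ g) => //.
  - exact: cvx_thicken.
  - by apply: sub_thicken => //; exact: ltW.
  - by apply: sub_thicken => //; exact: ltW.
  - by lra.
  - by rewrite e0 ltW.
  - by apply: le_trans hz; rewrite /b expr2; lra.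
pose f a := vol (fun y => L y /\ inner y x <= a).
have step a : f (a + 2 * b) <= f a + e / 2 * vol L.
  apply: le_trans (lerD (lexx _) (slab a)); apply: vol_subadd => //.
  move=> y [Ly h]; case: (leP (inner y x) a) => h'; [left|right] => //.
  by split=> //; rewrite h ltW.
have Lb y : L y -> `|inner y x| <= d%:R * 2.
  move=> Ly; apply: inner_le_sup => // i.
  have := thicken_cube z1 bK Ly i; rewrite mxE ler_norml => /andP[? ?].
  by apply/andP; split; lra.
(* The scan starts below the whole thickened set, on which the inner product with [x] is at least
   [- 2 d]. *)
pose a j : R := - (d%:R * 2) - 1 + j%:R * b.
have ex : exists j, e * vol L < f (a j).
  exists (Num.bound ((d%:R * 4 + 1) / b)); set j := Num.bound _.
  have aj : d%:R * 2 <= a j.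
    have : (d%:R * 4 + 1) / b < j%:R.
      by apply: archi_boundP; rewrite divr_ge0 ?addr_ge0 ?mulr_ge0 // ltW.
    by rewrite ltr_pdivrMr // /a; lra.
  apply: lt_le_trans (_ : vol L <= _); first by rewrite gtr_pMl.
  apply: vol_mono (bsub _) => y Ly; split=> //.
  by apply: le_trans aj; apply: le_trans (ler_norm _) (Lb _ Ly).
case: (ex_minnP ex) => j hj jmin; set p := a j in hj.
have hp : f (p - b) <= e * vol L.
  case: j jmin @p hj => [|j] jmin p hj.
    rewrite /f vol_set0 ?mulr_ge0 // ?ltW // => y [/Lb].
    by rewrite ler_norml => /andP[h _]; rewrite /p /a; lra.
  have -> : p - b = a j by rewrite /p /a -natr1; ring.
  by rewrite leNgt; apply/negP => /jmin; rewrite ltnn.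
exists p; split.
- have : exists y, L y /\ inner y x <= p.
    apply: contrapT => h.
    have f0 : f p = 0 by apply: vol_set0 => y hy; apply: h; exists y.
    by move: hj; rewrite f0 ltNge mulr_ge0 // ltW.
  move=> [y [Ly hy]]; have [k Kk] := inner_thicken x1 Ly.
  by rewrite ler_norml -/b => /andP[? ?]; exists k => //; lra.
(* Thickening shifts levels by at most [b], and one light slab separates [p + b] from [p - b], where
   [f] is still at most [e vol L]. *)
- apply: le_trans (_ : f (p + b) <= _).
    apply: vol_mono (bsub _) => y Ly; split.
      by apply: thickenS Ly => k [].
    have [k [_ Kk]] := inner_thicken x1 Ly.
    by rewrite ler_norml -/b => /andP[? ?]; lra.
  have := step (p - b); have -> : p - b + 2 * b = p + b by ring.
  nra.
move=> p' pp'.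
(* Acceptance keeps only levels above [p - b]. The part below [p - 2 b] is disjoint from it with gap
   [b], and has volume at least [e / 2 * vol L] because [f p > e vol L] and the slab in between is
   light. *)
apply: le_trans (_ : vol (fun y => L y /\ p - b <= inner y x) <= _).
  apply: vol_mono (bsub _) => y Ly; split.
    by apply: thickenS Ly => k [].
  have [k [_ Kk]] := inner_thicken x1 Ly.
  by rewrite ler_norml -/b => /andP[? ?]; lra.
have : f (p - 2 * b) + vol (fun y => L y /\ p - b <= inner y x) <= vol L.
  apply: (vol_superadd x1 b0) bL => [y y' [_ h] [_ h']|y []|y []] //; lra.
have := step (p - 2 * b); rewrite subrK; lra.
Qed.

End Cut.

(** * Elementary facts on the logarithm *)

Section Logarithm.
Implicit Types a b : R.

Lemma lnM a b : 0 < a -> 0 < b -> ln (a * b) = ln a + ln b.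
Proof. by move=> /RltP a0 /RltP b0; exact: ln_mult. Qed.

Lemma ln_homo a b : 0 < a -> a <= b -> ln a <= ln b.
Proof.
move=> a0; rewrite le_eqVlt => /orP[/eqP->//|ab].
by apply/ltW/RltP/ln_increasing; apply/RltP.
Qed.

Lemma ln_homo_lt a b : 0 < a -> a < b -> ln a < ln b.
Proof. by move=> a0 ab; apply/RltP/ln_increasing; apply/RltP. Qed.

Lemma ln_one : ln 1 = 0.
Proof. exact: ln_1. Qed.

Lemma lnV a : 0 < a -> ln a^-1 = - ln a.
Proof. by move=> /RltP a0; exact: ln_Rinv. Qed.

Lemma lnXn a n : 0 < a -> ln (a ^+ n) = n%:R * ln a.
Proof.
move=> a0; elim: n => [|n IH]; first by rewrite expr0 mul0r ln_one.
by rewrite exprS lnM ?exprn_gt0 // IH -[n.+1%:R]natr1; ring.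
Qed.

Lemma ln_le_subr1 a : 0 < a -> ln a <= a - 1.
Proof.
move=> a0; have h : 1 + ln a <= exp (ln a) by apply/RleP; exact: exp_ineq1_le.
by move: h; rewrite exp_ln; [lra|exact/RltP].
Qed.

Lemma ln2_ge : 1 / 2 <= ln 2%:R.
Proof.
have h0 : (0 : R) < 2^-1 by rewrite invr_gt0.
have := ln_le_subr1 h0; rewrite lnV //; lra.
Qed.

End Logarithm.

(** * Levels, potential and existence of good prices *)

Section Pricing.
Variable d : nat.
Hypothesis d0 : (0 < d)%N.
Implicit Types (x y u v : 'rV[R]_d) (K : 'rV[R]_d -> Prop).

(* Level [k] handles widths between [8 eps_(k+1)^2] and [8 eps_k^2]. *)
Definition eps k : R := 2^-1 ^+ (2 ^ k).

Lemma eps_gt0 k : 0 < eps k.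
Proof. by rewrite exprn_gt0 // invr_gt0. Qed.

Lemma epsS k : eps k.+1 = eps k ^+ 2.
Proof. by rewrite /eps expnS mulnC exprM. Qed.

Lemma eps_le k : eps k <= 1 / 2.
Proof.
elim: k => [|k IH]; first by rewrite /eps expr1 div1r.
by rewrite epsS expr2; have := eps_gt0 k; nra.
Qed.

Lemma eps_pow2 k : eps k <= (2 ^+ k)^-1.
Proof.
rewrite -exprVn; apply: ler_wiXn2l; rewrite ?invr_ge0 ?invf_le1 ?ler1n //.
by rewrite ltnW // ltn_expl.
Qed.

Lemma ln_eps k : ln (eps k) = - 2 ^+ k * ln 2%:R.
Proof. by rewrite lnXn ?invr_gt0 // lnV // natrX; ring. Qed.

Definition width_le (w : R) K x : Prop :=
  forall u v, K u -> K v -> inner v x - inner u x <= w.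

(* Chosen so that the last hypothesis of [exists_cut] holds with equality for the
   width [8 eps_(k+1)^2] and the fraction [eps_k / 4]. *)
Definition mesh k : R := eps k ^+ 5 / (40 * d%:R ^+ 2).

Lemma dR_ge1 : 1 <= d%:R :> R.
Proof. by rewrite ler1n. Qed.

Lemma mesh_gt0 k : 0 < mesh k.
Proof.
apply: divr_gt0; first by rewrite exprn_gt0 // eps_gt0.
by apply: mulr_gt0; [lra|rewrite exprn_gt0 // ltr0n].
Qed.

Lemma mesh_le k : d%:R * mesh k <= eps k ^+ 2.
Proof.
have e0 := eps_gt0 k; have e1 := eps_le k; have d1 := dR_ge1.
have h0 : 0 < 40 * d%:R ^+ 2 :> R by apply: mulr_gt0; [|rewrite exprn_gt0]; lra.
rewrite /mesh mulrA ler_pdivrMr // (_ : 5 = 2 + 3)%N // exprD.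
have h3 : eps k ^+ 3 <= 1 by apply: exprn_ile1; lra.
have h2 : 0 < eps k ^+ 2 by rewrite exprn_gt0.
have h4 : 0 < eps k ^+ 3 by rewrite exprn_gt0.
rewrite mulrCA ler_pM2l // expr2; nra.
Qed.

Lemma mesh_le1 k : mesh k <= 1.
Proof.
have := mesh_le k; have := mesh_gt0 k; have := dR_ge1; have := eps_gt0 k.
have := eps_le k; rewrite expr2; nra.
Qed.

Definition level_vol k K : R := vol (thicken (mesh k) K).

(* At level [k] a rejection lowers the logarithm by more than [2^k / 2] and an
   acceptance by at least [eps_k / 8], while [eps_k <= 2^-k]; with the weight
   [128 / 2^k] these pay for losses of [2] and [16 eps_k^2]. *)
Definition potential (N : nat) K : R :=
  \sum_(k < N) 128 / 2 ^+ k * ln (level_vol k K).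

Definition in_unit_ball K : Prop := forall y, K y -> in_ball y.

Lemma in_unit_ball_box K : in_unit_ball K -> in_box K.
Proof. by move=> bK y /bK By i; exact: in_ball_coord. Qed.

Lemma level_vol_ge k K v : in_unit_ball K -> K v -> mesh k ^+ d <= level_vol k K.
Proof.
move=> /in_unit_ball_box bK Kv; apply: vol_thicken_ge Kv => //.
by rewrite mesh_gt0 mesh_le1.
Qed.

Lemma level_vol_gt0 k K v : in_unit_ball K -> K v -> 0 < level_vol k K.
Proof.
by move=> bK /(level_vol_ge k bK); apply: lt_le_trans; rewrite exprn_gt0 // mesh_gt0.
Qed.

Lemma level_volS k K K' : in_unit_ball K -> (forall y, K' y -> K y) ->
  level_vol k K' <= level_vol k K.
Proof.
move=> bK KK; apply: vol_mono => [y|]; first exact: thickenS.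
by apply: thicken_coverable (mesh_le1 k) _; exact: in_unit_ball_box.
Qed.

Lemma coef_gt0 k : 0 < 128 / 2 ^+ k :> R.
Proof. by rewrite divr_gt0 // exprn_gt0. Qed.

Lemma potentialS N K K' v : in_unit_ball K -> (forall y, K' y -> K y) -> K' v ->
  potential N K' <= potential N K.
Proof.
move=> bK KK Kv; apply: ler_sum => k _; rewrite ler_pM2l ?coef_gt0 //.
apply: ln_homo; last exact: level_volS.
by apply: level_vol_gt0 Kv => y /KK/bK.
Qed.

(** The cut is credited at level [k] alone; monotonicity handles the other levels. *)
Lemma potential_drop N K K' v (k : 'I_N) (r : R) : in_unit_ball K ->
  (forall y, K' y -> K y) -> K' v -> 0 < r ->
  level_vol k K' <= r * level_vol k K ->
  potential N K' <= potential N K + 128 / 2 ^+ k * ln r.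
Proof.
move=> bK KK Kv r0 h; rewrite /potential (bigD1 k) //= [in leRHS](bigD1 k) //=.
have bK' : in_unit_ball K' by move=> y /KK/bK.
rewrite addrAC -mulrDr; apply: lerD.
  rewrite ler_pM2l ?coef_gt0 // [_ + ln r]addrC -lnM ?(level_vol_gt0 _ _ (KK _ Kv)) //.
  by apply: ln_homo h; exact: level_vol_gt0 Kv.
apply: ler_sum => j _; rewrite ler_pM2l ?coef_gt0 //.
by apply: ln_homo; [exact: level_vol_gt0 Kv|exact: level_volS].
Qed.

Definition upd K x (p : R) (b : bool) y : Prop := K y /\ (p <= inner y x) = b.

Lemma cvx_upd K x p b : cvx K -> cvx (upd K x p b).
Proof.
move=> cK l u v /andP[l0 l1] [Ku hu] [Kv hv]; split.
  by apply: cK; rewrite ?l0.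
rewrite inner_conv; case: b hu hv => [hu hv|/negbT + /negbT].
  by nra.
rewrite -!ltNge => hu hv; apply/negbTE; rewrite -ltNge.
have [->|ln1] := eqVneq l 1; first by lra.
have : l < 1 by rewrite lt_neqAle ln1.
by nra.
Qed.

(* For any possible value [v] in [K]: a rejection pays for the loss of a whole
   trade, and an acceptance pays for the loss [inner v x - p] up to [t]. *)
Definition good_price N (t : R) K x (p : R) : Prop := forall v, K v ->
  (inner v x < p -> 2 + potential N (upd K x p false) <= potential N K) /\
  (forall p' : R, p <= p' -> p' <= inner v x ->
    inner v x - p + potential N (upd K x p' true) <= potential N K + t).

Lemma width_level N K x : width_le (8 * eps 0 ^+ 2) K x ->
  width_le (8 * eps N ^+ 2) K x \/ exists2 k : 'I_N, width_le (8 * eps k ^+ 2) K x &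
    ~ width_le (8 * eps k.+1 ^+ 2) K x.
Proof.
move=> h0; elim: N => [|N [IH|[k h1 h2]]]; [by left| |].
- have [h|h] := pselect (width_le (8 * eps N.+1 ^+ 2) K x); first by left.
  by right; exists ord_max.
- by right; exists (widen_ord (leqnSn N) k).
Qed.

(** If the width is below the last level, a price [8 eps_N^2] under the value of some candidate is
    never rejected and loses at most [16 eps_N^2 <= t]. Otherwise [exists_cut] is applied at the
    level of the width. *)
Lemma exists_good_price N (t : R) K x : cvx K -> in_unit_ball K -> (exists v, K v) ->
  in_ball x -> 16 * eps N ^+ 2 <= t -> exists p, good_price N t K x p.
Proof.
move=> cK bK [v0 Kv0] x1 ht.
have x1' i : `|x 0 i| <= 1 by exact: in_ball_coord.
(* [8 eps_0^2 = 2] is the diameter of the unit ball. *)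
have : width_le (8 * eps 0 ^+ 2) K x.
  move=> u v /bK bu /bK bv; have := inner_ball bu x1; have := inner_ball bv x1.
  by rewrite /eps expr1 expr2 !ler_norml => /andP[? ?] /andP[? ?]; lra.
have t0 : 0 <= eps N ^+ 2 by rewrite exprn_ge0 // ltW // eps_gt0.
case/(width_level N) => [h|[k wk /existsNP[u /existsNP[v /not_implyP[Ku]]]]].
  exists (inner v0 x - 8 * eps N ^+ 2) => v Kv; have h1 := h _ _ Kv Kv0.
  split=> [|p' pp' p'v]; first by lra.
  have : potential N (upd K x p' true) <= potential N K.
    by apply: (@potentialS _ _ _ v) => // y [].
  by have := h _ _ Kv0 Kv; lra.
case/not_implyP => Kv /negP; rewrite -ltNge epsS => uv.
set e := eps k in wk uv *; have e0 : 0 < e := eps_gt0 k; have e1 := eps_le k.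
rewrite -/e in e1.
have [|||p [[y Ky yp] rej acc]] :=
  @exists_cut _ d0 K x u v (mesh k) (e / 4) (8 * e ^+ 2 ^+ 2) cK
    (in_unit_ball_box bK) x1' Ku Kv (ltW uv).
- by rewrite mesh_gt0 mesh_le1.
- by apply/andP; split; lra.
- rewrite /mesh -/e le_eqVlt; apply/orP; left; apply/eqP; field.
  by rewrite pnatr_eq0 -lt0n.
exists p => w Kw; split.
  move=> wp.
  have Uw : upd K x p false w by split=> //; apply/negbTE; rewrite -ltNge.
  have er : 0 < 2 * (e / 4) by lra.
  have le_lt : level_vol k (upd K x p false) <= 2 * (e / 4) * level_vol k K.
    apply: le_trans rej; apply: level_volS => [y' [/bK]|y' [Ky' /negbT]] //.
    by rewrite -ltNge.
  have := potential_drop bK (fun y h => proj1 h) Uw er le_lt.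
  have : ln (2 * (e / 4)) <= - 2 ^+ k * ln 2%:R by rewrite -ln_eps -/e; apply: ln_homo; lra.
  have k0 : 0 < 2 ^+ k :> R by rewrite exprn_gt0.
  move=> hl; have : 128 / 2 ^+ k * ln (2 * (e / 4)) <= - 64.
    rewrite mulrAC ler_pdivrMr //; have := ln2_ge; nra.
  by lra.
move=> p' pp' p'w.
have er : 0 < 1 - e / 4 / 2 by lra.
have Uw : upd K x p' true w by [].
have le_lt : level_vol k (upd K x p' true) <= (1 - e / 4 / 2) * level_vol k K.
  exact: acc.
have := potential_drop bK (fun y h => proj1 h) Uw er le_lt.
have : ln (1 - e / 4 / 2) <= - (e / 8).
  by apply: le_trans (ln_le_subr1 er) _; lra.
move=> hl; have : 128 / 2 ^+ k * ln (1 - e / 4 / 2) <= - (16 * e ^+ 2).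
  have := eps_pow2 k; rewrite -/e => e2.
  have k0 : 0 < (2 ^+ k)^-1 :> R by rewrite invr_gt0 exprn_gt0.
  rewrite expr2; nra.
(* The candidate [y] has value at most [p + d mesh_k <= p + e^2] and the width is at most [8 e^2],
   so the loss is at most [9 e^2]. *)
have := wk _ _ Ky Kw; have := mesh_le k; rewrite -/e; nra.
Qed.
End Pricing.

(** * The trading policy and its regret *)

Section Trade.
Variables (d : nat) (N : nat) (t : R).
Hypothesis d0 : (0 < d)%N.
Hypothesis ht : 16 * eps N ^+ 2 <= t.
Implicit Types (x y u v : vec d) (K : vec d -> Prop).

(** The default [0] is excluded by [price_good] for sets satisfying [candidates] and contexts in the
    ball. *)
Definition price K x : R := xget 0 (good_price N t K x : set R).

(* Candidates for the pair [(- s, b)]: the seller, who accepts [p] when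
   [- p <= inner (- s) x], is priced like a buyer with value vector [- s]. *)
Definition state : Type := (vec d -> Prop) * (vec d -> Prop).

Definition seller_price (st : state) x : R := - price st.1 x.

Definition buyer_price (st : state) x : R :=
  Num.max (seller_price st x) (price st.2 x).

(** The buyer's set is cut at the posted price, which may exceed [price st.2]; this is why
    [good_price] treats acceptances at every [p' >= p]. *)
Definition step (st : state) (xf : vec d * feedback) : state :=
  (upd st.1 xf.1 (price st.1 xf.1) xf.2.1,
   upd st.2 xf.1 (buyer_price st xf.1) xf.2.2).

Definition trade_policy : policy d := fun h x =>
  let st := foldl step (@in_ball d, @in_ball d) h in
  (seller_price st x, buyer_price st x).

Definition candidates K v : Prop := [/\ cvx K, in_unit_ball K & K v].

Lemma candidates_ball v : in_ball v -> candidates (@in_ball d) v.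
Proof.
move=> v1; split=> // l u w /andP[l0 l1]; rewrite /in_ball => u1 w1.
have := inner_ball u1 w1; rewrite ler_norml => /andP[_ uw].
have -> : inner ((1 - l) *: u + l *: w) ((1 - l) *: u + l *: w) =
  (1 - l) ^+ 2 * inner u u + 2 * (1 - l) * l * inner u w + l ^+ 2 * inner w w.
  rewrite /inner !mulr_sumr -!big_split /=; apply: eq_bigr => i _.
  by rewrite !mxE; ring.
have := ler_wpM2l (sqr_ge0 (1 - l)) u1.
have := ler_wpM2l (sqr_ge0 l) w1.
have : 0 <= 2 * (1 - l) * l by rewrite !mulr_ge0 // subr_ge0.
by move=> h; have := ler_wpM2l h uw; lra.
Qed.

Lemma candidates_upd K x p v b : candidates K v -> (p <= inner v x) = b ->
  candidates (upd K x p b) v.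
Proof.
by move=> [cK bK Kv] h; split=> //; [exact: cvx_upd|move=> y [/bK]].
Qed.

Lemma price_good K x v : candidates K v -> in_ball x ->
  good_price N t K x (price K x).
Proof.
move=> [cK bK Kv] x1; rewrite /price.
have [p gp] := exists_good_price d0 cK bK (ex_intro _ v Kv) x1 ht.
exact: (@xgetI _ 0 (good_price N t K x : set R) p).
Qed.

Lemma potential_upd K x p v b : candidates K v -> (p <= inner v x) = b ->
  potential N (upd K x p b) <= potential N K.
Proof.
by move=> [cK bK Kv] h; apply: (@potentialS _ d0 _ _ _ v) => // y [].
Qed.

(** At level [k] the volume is initially at most [4^d], and it is at least [mesh^d] as long as [v]
    survives. *)
Lemma potential_gap K v : candidates K v ->
  potential N (@in_ball d) - potential N K <=
  \sum_(k < N) 128 / 2 ^+ k * (d%:R * ln (4 / mesh d k)).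
Proof.
move=> [_ bK Kv]; have [_ bK0 K0v] := candidates_ball (bK _ Kv).
rewrite -sumrB; apply: ler_sum => k _; rewrite -mulrBr ler_pM2l ?coef_gt0 //.
have m0 := mesh_gt0 d0 k.
rewrite lnM ?invr_gt0 // lnV // mulrBr -!lnXn //.
apply: lerB; apply: ln_homo.
- exact: level_vol_gt0 K0v.
- by apply: vol_thicken_le; [exact: mesh_le1|exact: in_unit_ball_box].
- by rewrite exprn_gt0.
- exact: level_vol_ge Kv.
Qed.

Variables (s b : vec d) (x : nat -> vec d) (T : nat).
Hypothesis I : instance s b x T.

Let st i : state := foldl step (@in_ball d, @in_ball d) (hist trade_policy s b x i).

Lemma stS i : st i.+1 =
  (upd (st i).1 (x i) (price (st i).1 (x i)) (price (st i).1 (x i) <= inner (- s) (x i)),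
   upd (st i).2 (x i) (buyer_price (st i) (x i)) (buyer_price (st i) (x i) <= inner b (x i))).
Proof.
rewrite /st /= foldl_rcons /step /=.
congr (upd _ _ _ _, _).
by rewrite /fb_of /= /seller_price /Defs.sval innerN lerNr.
Qed.

Lemma st_candidates i : (i <= T)%N ->
  candidates (st i).1 (- s) /\ candidates (st i).2 b.
Proof.
case: I => [s1 [b1 x1]].
elim: i => [_|i IH iT].
  by split; apply: candidates_ball => //; exact: in_ballN.
by have [h1 h2] := IH (ltnW iT); rewrite stS; split; apply: candidates_upd.
Qed.

(* When the seller's price exceeds the buyer's, both post the seller's: a
   rejection by the buyer alone then bounds the gain from trade by [p - s]. *)
Lemma round_loss i : (i < T)%N ->
  Num.max (bval b x i - Defs.sval s x i) 0 - profit trade_policy s b x i <=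
  (potential N (st i).1 - potential N (st i.+1).1) +
  (potential N (st i).2 - potential N (st i.+1).2) + 2 * t.
Proof.
move=> iT; have [c1 c2] := st_candidates (ltnW iT).
have [s1 [b1 x1]] := I; have x1i := x1 _ iT.
have [_ _ Ks] := c1; have [_ _ Kb] := c2.
have [S1 S2] := price_good c1 x1i Ks; have [B1 B2] := price_good c2 x1i Kb.
have := inner_ball s1 x1i; have := inner_ball b1 x1i.
rewrite /profit /prices /trade_policy -/(st i) /= stS /= /bval /Defs.sval.
rewrite innerN in S1 S2 *; set sv := inner s _ in S1 S2 *; set bv := inner b _ in B1 B2 *.
have us p c := @potential_upd _ (x i) p _ c c1; rewrite innerN -/sv in us.
have ub p c := @potential_upd _ (x i) p _ c c2; rewrite -/bv in ub.
rewrite !ler_norml => /andP[bl bu] /andP[sl su].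
have t0 : 0 <= t by apply: le_trans ht; rewrite mulr_ge0 // sqr_ge0.
have /andP[mx0 mx2] : 0 <= Num.max (bv - sv) 0 <= 2.
  by rewrite le_max lexx orbT /= ge_max; apply/andP; split; lra.
rewrite [sv <= _]lerNr -/(seller_price _ _).
move: (potential N (st i).1) (potential N (st i).2) S1 S2 B1 B2 us ub => F G.
set P := price (st i).1 _; set q := buyer_price _ _ => S1 S2 B1 B2 us ub.
have qE : q = Num.max (- P) (price (st i).2 (x i)) by [].
have ubq := ub q _ erefl; have usP := us P _ erefl.
(* A rejection by the seller pays 2, the largest possible gain from trade; his acceptance pays for
   [- sv - P]. *)
case: (leP P (- sv)) usP => [Psv|svP] usP /=; last first.
  by have := S1 svP; lra.
have := S2 _ (lexx P) Psv.
(* When both accept, the loss is the sum of [- sv - P] and [bv - q], each paid by its own potential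
   up to [t]. *)
case: (leP q bv) ubq => [qb|bq] ubq hs /=.
  have pq : price (st i).2 (x i) <= q by rewrite qE le_max lexx orbT.
  have Pq : - P <= q by rewrite qE le_max lexx.
  have := B2 _ pq qb; rewrite max_l; [rewrite /seller_price -/P; lra|lra].
have [Pp|pP] := leP (- P) (price (st i).2 (x i)).
  have q_eq : q = price (st i).2 (x i) by rewrite qE max_r.
  by move: ubq bq; rewrite q_eq => ubq /B1; lra.
have q_eq : q = - P by rewrite qE max_l // ltW.
have : Num.max (bv - sv) 0 <= - sv - P by rewrite ge_max; apply/andP; split; lra.
by lra.
Qed.

Lemma regret_le_potential : det_regret trade_policy s b x T <=
  2 * (\sum_(k < N) 128 / 2 ^+ k * (d%:R * ln (4 / mesh d k))) + 2 * t * T%:R.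
Proof.
have h i : (i <= T)%N -> \sum_(j < i) Num.max (bval b x j - Defs.sval s x j) 0 -
    \sum_(j < i) profit trade_policy s b x j <=
    (potential N (st 0).1 - potential N (st i).1) +
    (potential N (st 0).2 - potential N (st i).2) + 2 * t * i%:R.
  elim: i => [_|i IH iT]; first by rewrite !big_ord0; lra.
  rewrite !big_ord_recr /= -[i.+1%:R]natr1.
  by have := IH (ltnW iT); have := round_loss iT; lra.
rewrite /det_regret RminusE; have := h T (leqnn T).
have [/potential_gap h1 /potential_gap h2] := st_candidates (leqnn T).
have -> : st 0 = (@in_ball d, @in_ball d) by [].
by rewrite /=; lra.
Qed.

End Trade.

(** * Budget balance, total cost of the levels and the final bound *)

Lemma prices_balanced d N t (s b : vec d) x i :
  (prices (trade_policy N t) s b x i).1 <= (prices (trade_policy N t) s b x i).2.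
Proof. by rewrite /prices /= /buyer_price le_max lexx. Qed.

Lemma sum_inv_pow2 N : \sum_(k < N) (2 ^+ k)^-1 <= 2 :> R.
Proof.
suff -> : \sum_(k < N) (2 ^+ k)^-1 = 2 - 2 * (2 ^+ N)^-1 :> R.
  by rewrite gerBl mulr_ge0 // invr_ge0 exprn_ge0.
elim: N => [|N IH]; first by rewrite big_ord0 expr0 invr1; lra.
by rewrite big_ord_recr /= IH exprS invfM; lra.
Qed.

(** The weight [2^-k] cancels the [2^k] in [ln (1 / eps k)], so this part costs the same at every
    level, while the part with [ln d] sums geometrically. *)
Lemma sum_level_cost d N : (0 < d)%N ->
  \sum_(k < N) 128 / 2 ^+ k * (d%:R * ln (4 / mesh d k)) <=
  d%:R * (256 * (ln 160%:R + 2 * ln d%:R) + 640 * (N%:R * ln 2%:R)).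
Proof.
move=> d0; have d1 : 1 <= d%:R :> R by rewrite ler1n.
have dp : 0 < d%:R :> R by lra.
have e k : 128 / 2 ^+ k * (d%:R * ln (4 / mesh d k)) =
    d%:R * (128 * (ln 160%:R + 2 * ln d%:R)) * (2 ^+ k)^-1 + 640 * d%:R * ln 2%:R.
  have ek := eps_gt0 k.
  have -> : 4 / mesh d k = 160%:R * d%:R ^+ 2 * (eps k ^+ 5)^-1.
    by rewrite /mesh; field; rewrite !gt_eqF.
  have -> : ln (160%:R * d%:R ^+ 2 * (eps k ^+ 5)^-1) =
      ln 160%:R + 2 * ln d%:R + 5 * (2 ^+ k * ln 2%:R).
    have p160 : 0 < 160%:R :> R by rewrite ltr0n.
    have d2 : 0 < d%:R ^+ 2 :> R by rewrite exprn_gt0.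
    have e5 : 0 < (eps k ^+ 5)^-1 by rewrite invr_gt0 exprn_gt0.
    rewrite (lnM (mulr_gt0 p160 d2) e5) (lnM p160 d2).
    by rewrite (lnV (exprn_gt0 5 ek)) (lnXn _ ek) ln_eps (lnXn _ dp); ring.
  by field; rewrite gt_eqF // exprn_gt0.
under eq_bigr do rewrite e.
rewrite big_split /= -mulr_sumr sumr_const card_ord -[_ *+ N]mulr_natr.
have h : 0 <= d%:R * (128 * (ln 160%:R + 2 * ln d%:R)).
  have l160 : 0 <= ln 160%:R by rewrite -ln_one; apply: ln_homo; rewrite ?ler1n.
  have ld : 0 <= ln d%:R by rewrite -ln_one; apply: ln_homo.
  by apply: mulr_ge0; lra.
by have := ler_wpM2l h (sum_inv_pow2 N); lra.
Qed.

Lemma ln_gt0 (a : R) : 1 < a -> 0 < ln a.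
Proof. by move=> a1; rewrite -ln_one; apply: ln_homo_lt. Qed.

Lemma ln3_gt1 : 1 < ln 3%:R.
Proof.
(* (8/7)^8 < 3 and ln (7/8) <= -1/8 *)
have h78 : 0 < 7 / 8 :> R by lra.
have h := ln_le_subr1 h78.
have h3 : 0 < (7 / 8) ^+ 8 * 3%:R :> R by rewrite mulr_gt0 ?exprn_gt0.
have := @ln_gt0 ((7 / 8) ^+ 8 * 3%:R).
rewrite lnM ?exprn_gt0 // lnXn // => /(_ _) hh.
have : 0 < 8 * ln (7 / 8) + ln 3%:R by apply: hh; lra.
by lra.
Qed.

(** Take the least such [N]: since [eps N = 2^(-2^N)], failure one level earlier forces
    [2^N = O(ln T)]. *)
Lemma number_of_levels T : (3 <= T)%N -> exists N,
  16 * eps N ^+ 2 <= T%:R^-1 /\ N%:R * ln 2%:R <= ln 8%:R + ln (ln T%:R).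
Proof.
move=> T3; have T0 : 0 < T%:R :> R by rewrite ltr0n (leq_trans _ T3).
have T3' : 3 <= T%:R :> R by rewrite (ler_nat _ 3).
pose ok N := 16 * T%:R * eps N ^+ 2 <= 1.
have ex : exists N, ok N.
  (* A crude witness: [N eps_N <= N / 2^N <= 1] and [eps_N <= 1]. *)
  exists (16 * T)%N; rewrite /ok; set N := (16 * T)%N.
  have N0 : 0 < N%:R :> R by rewrite ltr0n muln_gt0 (leq_trans _ T3).
  have e0 := eps_gt0 N; have e1 := eps_le N; have e2 := eps_pow2 N.
  have e3 : N%:R * eps N <= 1.
    apply: le_trans (_ : N%:R * (2 ^+ N)^-1 <= _).
      by rewrite ler_pM2l.
    rewrite ler_pdivrMr ?exprn_gt0 // mul1r -natrX ler_nat.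
    by rewrite ltnW // ltn_expl.
  by move: e3; rewrite /N natrM expr2; nra.
have lT : 1 < ln T%:R.
  apply: lt_le_trans (_ : ln 3%:R <= _); last exact: ln_homo.
  exact: ln3_gt1.
have llT := ln_gt0 lT.
case: (ex_minnP ex) => N okN minN; exists N; split.
  by rewrite -[leRHS]mul1r ler_pdivlMr // mulrAC.
case: N okN minN => [_ _|N _ minN].
  have l8 : 0 < ln 8%:R by apply: ln_gt0; rewrite ltr1n.
  by rewrite mul0r; lra.
have : ~~ ok N by apply/negP => /minN; rewrite ltnn.
rewrite /ok -ltNge => h.
have e0 := eps_gt0 N.
have h1 : 0 < ln (16 * T%:R) + 2 * ln (eps N).
  have T16 : 0 < 16 * T%:R :> R by lra.
  by rewrite -(lnXn 2 e0) -(lnM T16 (exprn_gt0 2 e0)); exact: ln_gt0.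
have h2 : ln (16 * T%:R) <= 4 * ln T%:R.
  rewrite -(lnXn 4 T0); apply: ln_homo; first by lra.
  by rewrite exprSr ler_pM2r // !exprS expr0 mulr1; nra.
have k0 : 0 < 2 ^+ N :> R by rewrite exprn_gt0.
have h3 : 2 ^+ N.+1 <= 8 * ln T%:R.
  move: h1; rewrite ln_eps exprS; have := ln2_ge; nra.
rewrite -lnXn // -lnM ?(lt_trans _ lT) //.
by apply: ln_homo h3; rewrite exprn_gt0.
Qed.

Theorem theorem5p3 :
  exists C : R, 0 < C /\
    forall (d T : nat), (1 <= d)%N -> (3 <= T)%N ->
      exists L : rand_alg d,
        is_distribution L /\ budget_balanced L T /\
        forall (s b : vec d) (x : nat -> vec d), instance s b x T ->
          exp_regret L s b x T <=
            C * (d%:R * ln (ln T%:R) + d%:R * ln d%:R).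
Proof.
(* Twice the constant terms of [sum_level_cost], with [N] bounded by [number_of_levels], plus
   [2 t T = 2] for [t = 1 / T]. *)
pose c := 512 * ln 160%:R + 1280 * ln 8%:R + 2.
have c0 : 0 < c.
  have l8 : 0 < ln 8%:R by apply: ln_gt0; rewrite ltr1n.
  have l160 : 0 < ln 160%:R by apply: ln_gt0; rewrite ltr1n.
  by rewrite /c; lra.
have l3 := ln_gt0 ln3_gt1.
have cl0 : 0 <= c / ln (ln 3%:R) by rewrite divr_ge0 // ltW.
(* As [ln (ln T) >= ln (ln 3) > 0], the first term absorbs [c]; [1280] is the coefficient of
   [d ln (ln T)] and exceeds the [1024] of [d ln d]. *)
exists (c / ln (ln 3%:R) + 1280); split; first by lra.
move=> d T d0 T3.
have [N [hN hNT]] := number_of_levels T3.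
exists [:: (1, trade_policy N T%:R^-1)]; split.
  by split; [move=> wa [<-|[]]|rewrite big_seq1].
split.
  by move=> wa [<-|[]] //= s b x _ t _; exact: prices_balanced.
move=> s b x I; rewrite /exp_regret big_seq1 mul1r.
apply: le_trans (regret_le_potential d0 hN I) _.
have T0 : 0 < T%:R :> R by rewrite ltr0n (leq_trans _ T3).
rewrite -mulrA mulVf ?gt_eqF // mulr1.
have := sum_level_cost N d0.
have d1 : 1 <= d%:R :> R by rewrite ler1n.
have ld : 0 <= ln d%:R by rewrite -ln_one; apply: ln_homo.
have lT : ln (ln 3%:R) <= ln (ln T%:R).
  apply: ln_homo; first by apply: ln_gt0; rewrite ltr1n.
  by apply: ln_homo; rewrite ?ltr0n ?ler_nat.
have cT : c <= c / ln (ln 3%:R) * ln (ln T%:R).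
  by rewrite mulrAC ler_pdivlMr // ler_pM2l.
have := ler_wpM2l (ler0n _ d) hNT.
have := ler_wpM2l (ler0n _ d) cT.
have dld : 0 <= d%:R * ln d%:R by rewrite mulr_ge0.
have := mulr_ge0 dld cl0.
by rewrite /c; lra.
Qed.
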